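(* Let $\mathcal M$ be a map on a surface with $n$ edges, with set of edges $E$ and set of coedges $E^*$. Put $\partial_0\mathcal M=\mathcal M$, and for $j\in\{1,\dots,n\}$ let $\partial_j\mathcal M$ be the partial dual of $\mathcal M$ with respect to the edge $j$. For $j\in\{0,1,\dots,n\}$ let $S_j$, $V_j$ and $V_j^*$ denote the underlying surface of $\partial_j\mathcal M$ and its sets of vertices and covertices, and let $$\mathcal H_j=H_1(S_j\setminus(V_j\cup V_j^* )),$$ homology being taken with coefficients in $\mathbb Q$. Let $\iota$ denote the incidence vector map from $\mathcal H_j$ to $\mathbb Q^E\oplus\mathbb Q^{E^*}$. Then the pair $(\iota(\mathcal H_0),\iota(\mathcal H_j))$ is a Lagrangian pair of subspaces of $\mathbb Q^E\oplus\mathbb Q^{E^*}$ whenever $j\neq 0$.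
   Context: A map $\mathcal M$ on a surface $S$ is a cellular embedding of a connected graph (loops and multiple edges allowed) into a connected, closed, orientable surface $S$, which is given the positive, counter-clockwise orientation; the components of the complement are the faces, each homeomorphic to an open 2-cell. The dual map $\mathcal M^*$ on $S$ has one vertex (covertex) in each face of $\mathcal M$, and for each edge $e$ an edge (coedge) $e^*$ joining the face-centres of the face(s) on the two sides of $e$, crossing $e$ exactly once and meeting no other edge of $\mathcal M$. $V,V^*,E,E^*$ denote the sets of vertices, covertices, edges and coedges. Cartographic description and partial dual: divide each edge into two half-edges and label the half-edges by $\{1,\dots,2n\}$, placing each label on the left when standing at a vertex and looking towards the adjacent edge midpoint. Then $\mathcal M$ is encoded by $\langle\sigma,\alpha,\varphi\rangle$, $\sigma,\alpha,\varphi\in S_{2n}$, where the disjoint cycles of $\sigma,\alpha,\varphi$ are the counter-clockwise cyclic orderings of labels around vertices, around edge midpoints, and within faces; $\alpha$ is a fixed-point free involution, $\sigma\alpha\varphi=1$, and the group generated is transitive; conversely such a triple determines a map up to isomorphism. Write $\alpha=c_1\cdots c_n$ as a product of disjoint transpositions, $c_j$ corresponding to the edge $j$. Then $\partial_j\mathcal M=\langle\sigma c_j,\alpha,c_j\varphi\rangle$. The edge of $\partial_j\mathcal M$ corresponding to $c_i$ is again labelled $i\in E$, and its coedge $i^*\in E^*$. Orthogonal space: $\mathbb Q^E\oplus\mathbb Q^{E^*}$ has basis $E\cup E^*$ and symmetric bilinear form with $\langle e,e^*\rangle=1$ and $\langle e,f\rangle=0$ whenever $f\ne e^*$ (where $e^{**}=e$).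 A Lagrangian subspace is a totally isotropic subspace of maximum dimension, namely $n$. Two Lagrangian subspaces form a Lagrangian pair (a pair of Lagrangian subspaces) if their intersection has dimension $n-1$. Incidence vectors: for a map on a surface $S$, orient the edges arbitrarily and orient each coedge $e^*$ so that it intersects $e$ from the right (after a counter-clockwise turn the orientation of $e$ coincides with that of $e^*$); the intersection index is then $(e,e^* )=1$, and it is $-1$ if $e^*$ intersects $e$ from the left. The intersection index extends to an intersection index $(c,e)$ of a class $c\in H_1(S\setminus(V\cup V^* ))$ with each $e\in E\cup E^*$. The incidence vector of $c$ is $\iota(c)=\sum_{e\in E\cup E^*}(c,e)\,e\in\mathbb Q^E\oplus\mathbb Q^{E^*}$. The construction is applied to $\mathcal M$ and to each $\partial_j\mathcal M$ on its surface $S_j$, with values in the same space $\mathbb Q^E\oplus\mathbb Q^{E^*}$.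
   Formalization: The arbitrary orientations of the edges of the map and of its partial dual at j are required to agree on every edge other than j (that of j is free in both); with unrelated orientations the claim fails, e.g. for the triangle on the sphere with one edge reversed. *)

(* Defs.v *)
From HB Require Import structures.
From mathcomp Require Import all_boot all_order all_fingroup all_algebra ring_quotient ring.

Set Implicit Arguments.
Unset Strict Implicit.
Unset Printing Implicit Defensive.

Import GRing.Theory Num.Theory.
Local Open Scope ring_scope.
Local Open Scope quotient_scope.

(* The quotient vector space vT / U: the library only has quotients of        *)
(* Z-modules by subgroups, which are here given their vector space structure. *)
Section QuotientSpace.
Import VectorInternalTheory.
Variables (K : fieldType) (vT : vectType K).

Definition quotv (U : {vspace vT}) : Type := Quotient.quot (pred_of_vspace U).

Variable U : {vspace vT}.
HB.instance Definition _ := GRing.Zmodule.on (quotv U).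

Definition quotv_pi (x : vT) : quotv U := \pi_(Quotient.quot (pred_of_vspace U)) x.
Definition quotv_repr (x : quotv U) : vT := generic_quotient.repr x.

Lemma quotv_reprK : cancel quotv_repr quotv_pi.
Proof. exact: reprK. Qed.

Lemma eq_quotv_pi x y : (quotv_pi x == quotv_pi y) = (x - y \in U).
Proof. by rewrite [RHS]Quotient.idealrBE. Qed.

Lemma quotv_repr_pi x : quotv_repr (quotv_pi x) - x \in U.
Proof. by rewrite -eq_quotv_pi quotv_reprK. Qed.

Lemma quotv_piD x y : quotv_pi (x + y) = quotv_pi x + quotv_pi y.
Proof. by rewrite /quotv_pi raddfD. Qed.

Definition quotv_scale (a : K) (x : quotv U) : quotv U :=
  quotv_pi (a *: quotv_repr x).

Lemma quotv_scale_pi a x : quotv_scale a (quotv_pi x) = quotv_pi (a *: x).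
Proof.
by apply/eqP; rewrite eq_quotv_pi -scalerBr memvZ ?quotv_repr_pi.
Qed.

Fact quotv_scaleA a b x :
  quotv_scale a (quotv_scale b x) = quotv_scale (a * b) x.
Proof. by rewrite -[x]quotv_reprK !quotv_scale_pi scalerA. Qed.
Fact quotv_scale1 : left_id 1 quotv_scale.
Proof. by move=> x; rewrite -[x]quotv_reprK quotv_scale_pi scale1r. Qed.
Fact quotv_scaleDr : right_distributive quotv_scale +%R.
Proof.
move=> a x y; rewrite -[x]quotv_reprK -[y]quotv_reprK.
by rewrite -quotv_piD !quotv_scale_pi scalerDr quotv_piD.
Qed.
Fact quotv_scaleDl x : {morph quotv_scale^~ x : a b / a + b}.
Proof.
move=> a b; rewrite -[x]quotv_reprK.
by rewrite !quotv_scale_pi scalerDl quotv_piD.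
Qed.

HB.instance Definition _ := GRing.Zmodule_isLmodule.Build K (quotv U)
  quotv_scaleA quotv_scale1 quotv_scaleDr quotv_scaleDl.

Fact quotv_pi_is_linear : linear quotv_pi.
Proof. by move=> a x y; rewrite quotv_piD -quotv_scale_pi. Qed.

HB.instance Definition _ :=
  GRing.isLinear.Build K vT (quotv U) *:%R quotv_pi quotv_pi_is_linear.

Let p : 'End(vT) := (\1 - projv U)%VF.
Let p_eq0 x : (p x == 0) = (x \in U).
Proof.
rewrite /p add_lfunE opp_lfunE id_lfunE subr_eq0; apply/eqP/idP => [->|Ux]; last by rewrite projv_id.
exact: memv_proj.
Qed.
Let v2r' (x : quotv U) := v2r (vsproj (limg p) (p (quotv_repr x))).
Let v2r'_pi x : v2r' (quotv_pi x) = v2r (vsproj (limg p) (p x)).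
Proof.
congr (v2r (vsproj _ _)); apply/eqP.
by rewrite -subr_eq0 -raddfB p_eq0 quotv_repr_pi.
Qed.

Fact quotv_axiom : Vector.axiom (\dim (limg p)) (quotv U).
Proof.
exists v2r'.
  move=> a x y; rewrite -[x]quotv_reprK -[y]quotv_reprK -linearP !v2r'_pi.
  by rewrite !linearP.
have v2r'_inj : injective v2r'.
  move=> x y /v2r_inj/(congr1 vsval); rewrite !vsprojK ?memv_img ?memvf //.
  move=> /eqP; rewrite -subr_eq0 -raddfB p_eq0 -eq_quotv_pi !quotv_reprK.
  by move/eqP.
pose g r := quotv_pi (vsval (r2v r : subvs_of (limg p))).
have gK : cancel g v2r'.
  move=> r; rewrite /g v2r'_pi; set w := r2v r.
  suff -> : p (vsval w) = vsval w by rewrite vsvalK r2vK.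
  have /memv_imgP[z _ ->] := subvsP w.
  apply/eqP; rewrite -subr_eq0 -raddfB p_eq0.
  by rewrite /p add_lfunE opp_lfunE id_lfunE addrAC subrr add0r memvN memv_proj.
by exists g => // x; apply: v2r'_inj; rewrite gK.
Qed.

HB.instance Definition _ := Lmodule_hasFinDim.Build K (quotv U) quotv_axiom.

End QuotientSpace.

(* A map with n edges in its cartographic description.  The label x lies on   *)
(* the left of the half-edge that carries it.  Permutations are composed from *)
(* left to right, (s * t)%g x = t (s x), which is the convention for which    *)
(* sigma * alpha * phi = 1 holds with such labels: the next label             *)
(* counter-clockwise in a face is phi x = sigma^-1 (alpha x).  The vertices   *)
(* are the cycles of sigma, the covertices (faces) those of phi, and the      *)
(* cycles of alpha are numbered by the edges 'I_n through edge_of.            *)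
Record cmap (n : nat) := Cmap {
  sigma : 'S_n.*2;
  alpha : 'S_n.*2;
  phi : 'S_n.*2;
  edge_of : 'I_n.*2 -> 'I_n;
  alpha_invol : involutive alpha;
  alpha_neq : forall x, alpha x != x;
  sigma_alpha_phi : (sigma * alpha * phi)%g = 1%g;
  cmap_trans :
    [transitive <<[set sigma; alpha; phi]>>, on [set: 'I_n.*2] | 'P];
  edge_ofP : forall x y, (edge_of x == edge_of y) = (y \in porbit alpha x)
}.

Section PartialDual.
Variables (n : nat) (M : cmap n) (j : 'I_n).
Local Notation sigma := (sigma M).
Local Notation alpha := (alpha M).
Local Notation phi := (phi M).
Local Notation edge_of := (edge_of M).

Lemma edge_of_alpha x : edge_of (alpha x) = edge_of x.
Proof. by apply/eqP; rewrite eq_sym edge_ofP; apply: (mem_porbit _ 1). Qed.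

(* The cycle c_j of alpha. *)
Definition edge_cycle : 'S_n.*2 := restr_perm [set x | edge_of x == j] alpha.

Lemma edge_cycleE x : edge_cycle x = if edge_of x == j then alpha x else x.
Proof.
have nA : alpha \in ('N([set x | edge_of x == j] | 'P))%g.
  by rewrite !inE /=; apply/subsetP=> y; rewrite !inE /= /aperm edge_of_alpha.
case: ifP => xj; first by rewrite (restr_permE nA) ?inE ?xj.
by rewrite (out_perm (restr_perm_on _ _)) ?inE ?xj.
Qed.


Lemma edge_cycle_tperm x : edge_of x = j -> edge_cycle = tperm x (alpha x).
Proof.
move=> xj; apply/permP=> y; rewrite edge_cycleE.
have xjE z : edge_of z == j = (z \in porbit alpha x).
  by rewrite -xj eq_sym edge_ofP.
case: tpermP => [->|->|/eqP yx /eqP yax].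
- by rewrite xj eqxx.
- by rewrite edge_of_alpha xj eqxx alpha_invol.
rewrite xjE; case: ifP => // /porbitP[i yE]; suff: (y == x) || (y == alpha x).
  by rewrite (negPf yx) (negPf yax).
rewrite yE; elim: i {yE} => [|i IH]; first by rewrite expg0 perm1 eqxx.
rewrite expgSr permM; case/orP: IH => /eqP->; first by rewrite eqxx orbT.
by rewrite alpha_invol eqxx.
Qed.

Fact partial_dual_product :
  (sigma * edge_cycle * alpha * (edge_cycle * phi))%g = 1%g.
Proof.
have cac : (edge_cycle * alpha * edge_cycle)%g = alpha.
  apply/permP=> x; rewrite !permM (edge_cycleE x); case: ifP => xj.
    by rewrite alpha_invol edge_cycleE xj.
  by rewrite edge_cycleE edge_of_alpha xj.
by rewrite mulgA -(mulgA sigma) -(mulgA sigma) cac sigma_alpha_phi.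
Qed.

Fact partial_dual_trans :
  [transitive <<[set (sigma * edge_cycle)%g; alpha; (edge_cycle * phi)%g]>>,
     on [set: 'I_n.*2] | 'P].
Proof.
set G' := <<_>>%g; set c := edge_cycle.
have G's : (sigma * c)%g \in G' by rewrite mem_gen // !inE eqxx.
have G'a : alpha \in G' by rewrite mem_gen // !inE eqxx orbT.
have G'p : (c * phi)%g \in G' by rewrite mem_gen // !inE eqxx orbT.
have [x _ _] := imsetP (cmap_trans M).
apply/imsetP; exists x => //; apply/esym/eqP; rewrite eqEsubset subsetT /=.
set O := orbit _ _ x.
have act_O g y : g \in G' -> y \in O -> g y \in O.
  by move=> gG; apply: orbit_trans; apply: (mem_orbit 'P y gG).
have cO y : y \in O -> c y \in O.
  by move=> yO; rewrite edge_cycleE; case: ifP => // _; apply: act_O.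
have cK y : c (c y) = y.
  rewrite !edge_cycleE; case: (edge_of y == j) / eqP => [yj|/eqP/negPf-> //].
  by rewrite edge_of_alpha yj eqxx alpha_invol.
have nO : (<<[set sigma; alpha; phi]>> \subset 'N(O | 'P))%g.
  rewrite gen_subG; apply/subsetP=> g; rewrite !inE -orbA.
  case/or3P => /eqP->; rewrite ?inE /=; apply/subsetP=> y yO;
    rewrite inE /= /aperm.
  - by rewrite -(cK (sigma y)); apply: cO; rewrite -permM; apply: act_O.
  - exact: act_O.
  - by rewrite -(cK y) -(permM c phi); apply: act_O => //; apply: cO.
rewrite -(atransP (cmap_trans M) x (in_setT x)) acts_sub_orbit //.
exact: orbit_refl.
Qed.

Definition partial_dual : cmap n :=
  @Cmap n (sigma * edge_cycle)%g alpha (edge_cycle * phi)%g edge_of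
    (@alpha_invol n M) (@alpha_neq n M) partial_dual_product
    partial_dual_trans (@edge_ofP n M).

End PartialDual.

(* S cut along all edges and coedges consists of one quadrilateral for each   *)
(* label x, bounded by the half-edges of x and sigma x and by two             *)
(* half-coedges.  The dual cell decomposition of S has                        *)
(* - one 0-cell in each quadrilateral x;                                      *)
(* - two 1-cells for each label x: one crossing the half-edge of x            *)
(*   counter-clockwise around its vertex, from the quadrilateral              *)
(*   sigma^-1 x to x, and one crossing the half-coedge on the left of the     *)
(*   half-edge of x counter-clockwise around its covertex, from the           *)
(*   quadrilateral x to phi x;                                                *)
(* - one 2-cell around each vertex, covertex and edge midpoint.               *)
(* S minus vertices and covertices retracts by deformation onto the           *)
(* subcomplex formed of all cells except the 2-cells around vertices and      *)
(* covertices.  Its cellular chain complex C2 -> C1 -> C0 is the following;   *)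
(* the two components of C1 are the coefficients of the 1-cells crossing      *)
(* half-edges and half-coedges, and the 2-cells are oriented clockwise, so    *)
(* that each of the four 1-cells in their boundary has coefficient 1.         *)
Section Homology.
Variables (n : nat) (M : cmap n).
Local Notation sigma := (sigma M).
Local Notation alpha := (alpha M).
Local Notation phi := (phi M).
Local Notation edge_of := (edge_of M).
Local Notation C0 := 'rV[rat]_n.*2.
Local Notation C1 := ('rV[rat]_n.*2 * 'rV[rat]_n.*2)%type.
Local Notation C2 := 'rV[rat]_n.

Definition boundary1 (c : C1) : C0 :=
  \row_x (c.1 0 x - c.1 0 (sigma x) + (c.2 0 ((phi^-1)%g x) - c.2 0 x)).

Definition boundary2 (b : C2) : C1 :=
  (\row_x b 0 (edge_of x), \row_x b 0 (edge_of x)).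

Fact boundary1_is_linear : linear boundary1.
Proof. by move=> a [u1 u2] [v1 v2]; apply/rowP=> x; rewrite !mxE; ring. Qed.
HB.instance Definition _ :=
  GRing.isLinear.Build rat C1 C0 *:%R boundary1 boundary1_is_linear.

Fact boundary2_is_linear : linear boundary2.
Proof. by move=> a u v; congr (_, _); apply/rowP=> x; rewrite !mxE. Qed.
HB.instance Definition _ :=
  GRing.isLinear.Build rat C2 C1 *:%R boundary2 boundary2_is_linear.

Lemma phiE x : phi x = (sigma^-1)%g (alpha x).
Proof.
have /permP/(_ ((sigma^-1)%g (alpha x))) := sigma_alpha_phi M.
by rewrite !permM permKV alpha_invol perm1.
Qed.

Lemma phiVE x : (phi^-1)%g x = alpha (sigma x).
Proof. by apply: (@perm_inj _ phi); rewrite permKV phiE alpha_invol permK. Qed.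

Lemma boundary1_boundary2 b : boundary1 (boundary2 b) = 0.
Proof.
apply/rowP=> x; rewrite !mxE phiVE edge_of_alpha; ring.
Qed.

Definition cycles1 : {vspace C1} := lker (linfun boundary1).
Definition boundaries1 : {vspace C1} := limg (linfun boundary2).

Lemma boundaries1_sub_cycles1 : (boundaries1 <= cycles1)%VS.
Proof.
apply/subvP=> _ /memv_imgP[b _ ->].
by rewrite memv_ker !lfunE /= boundary1_boundary2.
Qed.

(* The argument of quotv is boundaries1 seen as a subspace of cycles1.        *)
Definition H1 : vectType rat :=
  quotv (linfun (vsval : subvs_of cycles1 -> C1) @^-1: boundaries1)%VS.

(* tail i is the label of the half-edge where the oriented edge i starts.     *)
Definition is_orientation (tail : 'I_n -> 'I_n.*2) :=
  forall i, edge_of (tail i) = i.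

(* The components are the coefficients of the edges and of the coedges.       *)
Local Notation W := ('rV[rat]_n * 'rV[rat]_n)%type.

Variable tail : 'I_n -> 'I_n.*2.

(* Write t for the label of the half-edge where the oriented edge e starts,   *)
(* and e' for its coedge, which crosses e from right to left, (e, e') = 1.    *)
(* - (e', e) = -1, so (c, e) counts the crossings of e from left to right.    *)
(*   The 1-cell through the half-edge of t crosses e from right to left, the  *)
(*   one through the half-edge of alpha t from left to right.                 *)
(* - (e, e') = 1, so (c, e') counts the crossings of e' in the direction of   *)
(*   e.  The 1-cell through the half-coedge on the left of t runs in this     *)
(*   direction, the one through the half-coedge on the left of alpha t (on    *)
(*   the right of e) in the opposite one.                                     *)
Definition intersection_edge (c : C1) (i : 'I_n) : rat :=
  c.1 0 (alpha (tail i)) - c.1 0 (tail i).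
Definition intersection_coedge (c : C1) (i : 'I_n) : rat :=
  c.2 0 (tail i) - c.2 0 (alpha (tail i)).

Definition incidence_chain (c : C1) : W :=
  (\row_i intersection_edge c i, \row_i intersection_coedge c i).

Fact incidence_chain_is_linear : linear incidence_chain.
Proof.
move=> a [u1 u2] [v1 v2]; congr (_, _); apply/rowP=> i;
  rewrite !mxE /intersection_edge /intersection_coedge /= !mxE; ring.
Qed.
HB.instance Definition _ :=
  GRing.isLinear.Build rat C1 W *:%R incidence_chain incidence_chain_is_linear.

Lemma incidence_chain_boundary c : c \in boundaries1 -> incidence_chain c = 0.
Proof.
move=> /memv_imgP[b _ ->]; rewrite lfunE; congr (_, _); apply/rowP=> i;
  by rewrite !mxE /intersection_edge /intersection_coedge /= !mxE edge_of_alpha subrr.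
Qed.

Definition incidence_vector (h : H1) : W :=
  incidence_chain (vsval (quotv_repr h)).

Lemma incidence_vector_pi (z : subvs_of cycles1) :
  incidence_vector (quotv_pi _ z) = incidence_chain (vsval z).
Proof.
apply/eqP; rewrite -subr_eq0 -raddfB -raddfB; apply/eqP.
apply: incidence_chain_boundary.
set U := (X in quotv_pi X).
have: quotv_repr (quotv_pi U z) - z \in U by exact: quotv_repr_pi.
by rewrite -memv_preim lfunE.
Qed.

Fact incidence_vector_is_linear : linear incidence_vector.
Proof.
move=> a x y; rewrite -[x]quotv_reprK -[y]quotv_reprK -linearP.
by rewrite !incidence_vector_pi !linearP.
Qed.
HB.instance Definition _ :=
  GRing.isLinear.Build rat H1 W *:%R incidence_vector incidence_vector_is_linear.

Definition incidence_space : {vspace W} := limg (linfun incidence_vector).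

End Homology.

Section Lagrangian.
Variable n : nat.
Local Notation W := ('rV[rat]_n * 'rV[rat]_n)%type.

(* The form for which each edge is dual to its coedge and orthogonal to the   *)
(* rest of the basis.                                                         *)
Definition hyp_form (u v : W) : rat :=
  \sum_i (u.1 0 i * v.2 0 i + u.2 0 i * v.1 0 i).

Definition isotropic (L : {vspace W}) :=
  forall u v, u \in L -> v \in L -> hyp_form u v = 0.

Lemma isotropic_dim (L : {vspace W}) : isotropic L -> (\dim L <= n)%N.
Proof.
move=> L0; pose d (u : 'rV[rat]_n) : W := (u, u).
have d_lin : linear d by [].
pose dL := GRing.isLinear.Build rat _ W *:%R d d_lin.
pose D : {linear 'rV[rat]_n -> W} := HB.pack d dL.
pose P := limg (linfun D).
have dimP : \dim P = n.
  rewrite limg_dim_eq ?dimvf /dim /= ?mul1n //.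
  apply/eqP; rewrite -subv0; apply/subvP=> u; rewrite memv_cap memv_ker.
  by rewrite (lfunE D) memv0 => /andP[_ /eqP[->]].
have LP0 : (L :&: P = 0)%VS.
  apply/eqP; rewrite -subv0; apply/subvP=> w; rewrite memv_cap => /andP[wL].
  case/memv_imgP=> u _; rewrite (lfunE D) => wE; rewrite memv0.
  have := L0 _ _ wL wL; rewrite wE /hyp_form /= => sum0.
  suff -> : u = 0 by [].
  apply/rowP=> i; rewrite mxE; apply/eqP.
  have ge0 k : true -> (0 <= u 0 k * u 0 k + u 0 k * u 0 k)%R.
    by move=> _; rewrite addr_ge0 // -expr2 sqr_ge0.
  have /eqP : u 0 i * u 0 i + u 0 i * u 0 i = 0 by exact: (psumr_eq0P ge0 sum0).
  by rewrite -mulr2n mulrn_eq0 /= mulf_eq0 orbb.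
have := dimvS (subvf (L + P)%VS); have := dimv_sum_cap L P.
rewrite LP0 dimv0 addn0 dimP dimvf => ->.
have -> : dim W = (n + n)%N by rewrite -[in RHS](mul1n n).
by rewrite leq_add2r.
Qed.

(* n is the maximum dimension of an isotropic subspace, by isotropic_dim.     *)
Definition lagrangian (L : {vspace W}) :=
  isotropic L /\ \dim L = n.

Definition lagrangian_pair (L1 L2 : {vspace W}) :=
  [/\ lagrangian L1, lagrangian L2 & \dim (L1 :&: L2) = (n - 1)%N].

End Lagrangian.

(* Main.v *)
(* For a chain c = (a, b), put g x = a x - b x and h x = a x - b (alpha x);    *)
(* c is a cycle iff g = h o sigma.  Polarizing 2 u_i v_i = sum (g^2 - h^2)    *)
(* over the two labels of the edge i, for the coordinates u, v of the         *)
(* incidence vector, shows that incidence spaces are isotropic; counting      *)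
(* dimensions shows that they are Lagrangian.  Replacing (a, b) by (-b, -a)   *)
(* on the edge j alone maps the cycles of M to cycles of its partial dual,    *)
(* and acts on incidence vectors by exchanging the coordinates j and j^*, up  *)
(* to a common sign: a reflection in a non-isotropic vector.  A Lagrangian    *)
(* subspace and its image under such a reflection form a Lagrangian pair.     *)
Require Import Defs.
From HB Require Import structures.
From mathcomp Require Import all_boot all_order all_fingroup all_algebra.
From mathcomp Require Import ring.

Set Implicit Arguments.
Unset Strict Implicit.
Unset Printing Implicit Defensive.

Import GRing.Theory Num.Theory.
Local Open Scope ring_scope.

Local Notation W n := ('rV[rat]_n * 'rV[rat]_n)%type.

(** Isotropy ([incidence_space_isotropic]) bounds the dimension of an incidence space by n.
    Conversely, cycles have dimension at least 2n+1 ([dim_cycles1]) and incidence kills at most n+1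
    of it ([dim_cycles1_ker_incidence]), so the space is Lagrangian. [dual_chain] carries it into
    that of the partial dual by a reflection, and [lagrangian_pair_swap] concludes. *)

Lemma edge_of_eq n (M : cmap n) (x y : 'I_n.*2) :
  (edge_of M y == edge_of M x) = (y == x) || (y == alpha M x).
Proof.
apply/idP/orP => [/eqP yx|[]/eqP->]; rewrite ?edge_of_alpha //.
have := edge_cycleE M (edge_of M x) y; rewrite yx eqxx (edge_cycle_tperm erefl).
case: tpermP => [->|->|_ _ /esym/eqP]; rewrite ?eqxx; [by left | by right |].
by rewrite (negPf (alpha_neq M y)).
Qed.

Lemma sum_edge n (M : cmap n) tail (F : 'I_n.*2 -> rat) :
  is_orientation M tail ->
  \sum_x F x = \sum_i (F (tail i) + F (alpha M (tail i))).
Proof.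
move=> tailP; rewrite (partition_big (edge_of M) xpredT) //=.
apply: eq_bigr => i _; rewrite (bigD1 (tail i)) ?tailP //=; congr (_ + _).
rewrite (big_pred1 (alpha M (tail i))) // => x.
rewrite -{1}(tailP i) edge_of_eq; case: eqVneq => [->|_]; rewrite ?andbT //=.
by rewrite eq_sym (negPf (alpha_neq M _)).
Qed.

(** * Cycles and isotropy *)

Lemma cycles1P n (M : cmap n) (c : W n.*2) :
  reflect (forall x, c.1 0 x - c.2 0 x
             = c.1 0 (sigma M x) - c.2 0 (alpha M (sigma M x)))
          (c \in cycles1 M).
Proof.
rewrite memv_ker lfunE /=; apply: (iffP eqP) => [/rowP c0 x|cE].
  have := c0 x; rewrite !mxE phiVE => c0x.
  apply/eqP; rewrite -subr_eq0 -c0x; apply/eqP; ring.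
apply/rowP=> x; rewrite !mxE phiVE; move/eqP: (cE x); rewrite -subr_eq0.
move/eqP=> <-; ring.
Qed.

(** Every cycle represents a class, so homology can be replaced by cycles from here on. *)
Lemma incidence_spaceE n (M : cmap n) tail :
  incidence_space M tail = (linfun (incidence_chain M tail) @: cycles1 M)%VS.
Proof.
apply/vspaceP=> w; apply/memv_imgP/memv_imgP=> [[h _ ->]|[c cM ->]].
  exists (vsval (quotv_repr h)); first exact: subvsP.
  by rewrite !lfunE.
exists (quotv_pi _ (vsproj (cycles1 M) c)); first exact: memvf.
by rewrite !lfunE /= incidence_vector_pi vsprojK.
Qed.

Lemma incidence_space_isotropic n (M : cmap n) tail :
  is_orientation M tail -> isotropic (incidence_space M tail).
Proof.
move=> tailP u v; rewrite incidence_spaceE.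
move=> /memv_imgP[c cM ->] /memv_imgP[d dM ->]; rewrite !lfunE /hyp_form /=.
pose g (c : W n.*2) x := c.1 0 x - c.2 0 x.
pose h (c : W n.*2) x := c.1 0 x - c.2 0 (alpha M x).
transitivity (\sum_x (g c x * g d x - h c x * h d x)).
  rewrite (sum_edge _ tailP); apply: eq_bigr => i _.
  rewrite !mxE /intersection_edge /intersection_coedge /g /h alpha_invol; ring.
rewrite sumrB; apply/eqP; rewrite subr_eq0; apply/eqP.
rewrite [RHS](reindex_inj (@perm_inj _ (sigma M))) /=.
by apply: eq_bigr => x _; rewrite /g (cycles1P _ _ cM) (cycles1P _ _ dM).
Qed.

(** * Dimension count *)

Lemma cmap_invariant n (M : cmap n) (T : eqType) (f : 'I_n.*2 -> T) :
  (forall x, f (sigma M x) = f x) -> (forall x, f (alpha M x) = f x) ->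
  forall x y, f x = f y.
Proof.
move=> fs fa x y.
have fp z : f (phi M z) = f z.
  by rewrite phiE -[RHS]fa -{2}(permKV (sigma M) (alpha M z)) fs.
have /imsetP[z _ zE] := cmap_trans M.
suff fz t : f t = f z by rewrite !fz.
have : t \in [set: 'I_n.*2] by rewrite inE.
rewrite zE => /orbitP[p pG <-].
(* The permutations preserving [f] form a group containing the three generators. *)
have : p \in [set p : 'S_n.*2 | [forall t, f (p t) == f t]].
  set A := [set _ | _].
  have gA : group_set A.
    apply/group_setP; split; first by rewrite inE; apply/forallP=> u; rewrite perm1.
    move=> q r; rewrite !inE => /forallP qA /forallP rA; apply/forallP=> u.
    by rewrite permM (eqP (rA _)) (eqP (qA _)).
  rewrite -[A]/(gval (Group gA)); move: p pG; apply/subsetP; rewrite gen_subG.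
  apply/subsetP=> q; rewrite !inE -orbA.
  by case/or3P=> /eqP->; apply/forallP=> u; rewrite ?fs ?fa ?fp.
by rewrite inE => /forallP/(_ z)/eqP.
Qed.

Lemma dim_pair n : dim (W n) = (n + n)%N.
Proof. by rewrite -[in RHS](mul1n n). Qed.

Lemma dim_row n : dim 'rV[rat]_n = n.
Proof. exact: mul1n. Qed.

(** The coordinates of a boundary sum to 0, so [boundary1] misses the basis vectors and has rank
    less than 2n on a space of dimension 4n. *)
Lemma dim_cycles1 n (M : cmap n) : (0 < n)%N -> (n.*2 < \dim (cycles1 M))%N.
Proof.
move=> n_gt0; have n2_gt0 : (0 < n.*2)%N by rewrite double_gt0.
have := limg_ker_dim (linfun (boundary1 M)) fullv.
rewrite capfv dimvf dim_pair => dimE.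
suff imgS : (\dim (limg (linfun (boundary1 M))) < n.*2)%N.
  by rewrite -(ltn_add2r (\dim (limg (linfun (boundary1 M))))) dimE ltn_add2l.
rewrite -[ltnRHS]dim_row -dimvf ltn_neqAle dimvS ?subvf // andbT.
apply/negP=> /eqP dimf.
have /eqP imgf : limg (linfun (boundary1 M)) == fullv.
  by rewrite eqEdim subvf /= dimf.
pose x0 := Ordinal n2_gt0.
have /memv_imgP[c _] : delta_mx 0 x0 \in limg (linfun (boundary1 M)).
  by rewrite imgf memvf.
rewrite lfunE /= => /rowP cE.
have : \sum_x (delta_mx 0 x0 : 'rV[rat]__) 0 x = \sum_x boundary1 M c 0 x.
  by apply: eq_bigr => x _; rewrite cE.
rewrite (bigD1 x0) //= big1 => [|x /negPf xx0]; last by rewrite mxE xx0 andbF.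
under [RHS]eq_bigr do rewrite mxE.
rewrite mxE !eqxx addr0 big_split /= !sumrB.
have sum_perm (p : 'S_n.*2) (f : 'I_n.*2 -> rat) : \sum_x f (p x) = \sum_x f x.
  by rewrite [RHS](reindex_inj (@perm_inj _ p)).
rewrite (sum_perm _ (fun x => c.1 0 x)) (sum_perm _ (fun x => c.2 0 x)).
by rewrite !subrr => /eqP; rewrite oner_eq0.
Qed.

(* A cycle meeting no edge and no coedge is constant on each edge in both     *)
(* components, and by transitivity these differ by a global constant.         *)
Lemma dim_cycles1_ker_incidence n (M : cmap n) tail : is_orientation M tail ->
  (\dim (cycles1 M :&: lker (linfun (incidence_chain M tail))) <= n.+1)%N.
Proof.
(* [k] is the sum of the small loops around all vertices. *)
move=> tailP; pose k : W n.*2 := (const_mx 1, 0).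
apply: (@leq_trans (\dim (boundaries1 M + <[k]>))); last first.
  apply: leq_trans (dimv_add_leqif _ _) _.
  rewrite -(addn1 n) leq_add ?dim_vline ?leq_b1 //.
  rewrite -[leqRHS]dim_row -dimvf.
  by rewrite -(limg_ker_dim (linfun (boundary2 M)) fullv) leq_addl.
apply/dimvS/subvP=> c; rewrite memv_cap => /andP[/cycles1P cM].
rewrite memv_ker lfunE => /eqP[/rowP c1 /rowP c2].
have inv f : (forall i, f (tail i) = f (alpha M (tail i)) :> rat) ->
    forall x, f (alpha M x) = f x.
  move=> ft x; have := tailP (edge_of M x) => /eqP.
  rewrite eq_sym edge_of_eq => /orP[]/eqP->; rewrite ?alpha_invol.
    by rewrite -ft.
  exact: ft.
have inv1 : forall x, c.1 0 (alpha M x) = c.1 0 x.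
  apply: inv => i; apply/esym/eqP; rewrite -subr_eq0.
  by have := c1 i; rewrite !mxE /intersection_edge => ->.
have inv2 : forall x, c.2 0 (alpha M x) = c.2 0 x.
  apply: inv => i; apply/eqP; rewrite -subr_eq0.
  by have := c2 i; rewrite !mxE /intersection_coedge => ->.
have cst x y : c.1 0 x - c.2 0 x = c.1 0 y - c.2 0 y.
  apply: (cmap_invariant (M := M) (f := fun x => c.1 0 x - c.2 0 x)) => z.
    by rewrite [RHS]cM inv2.
  by rewrite inv1 inv2.
have bE x : c.2 0 (tail (edge_of M x)) = c.2 0 x.
  have := tailP (edge_of M x) => /eqP.
  by rewrite edge_of_eq => /orP[]/eqP->.
have [x0|nx] := pickP (@predT 'I_n.*2).
  move=> _; apply/memv_addP; exists (boundary2 M (\row_i c.2 0 (tail i))).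
    by rewrite -lfunE memv_img ?memvf.
  exists ((c.1 0 x0 - c.2 0 x0) *: k); first by rewrite memvZ ?memv_line.
  rewrite [LHS]surjective_pairing; congr (_, _); apply/rowP=> x;
    rewrite !mxE bE ?mulr0 ?addr0 //.
  by rewrite mulr1 (cst x0 x) addrC subrK.
suff -> : c = 0 by rewrite mem0v.
by rewrite [LHS]surjective_pairing; congr (_, _); apply/rowP=> x; have := nx x.
Qed.

Lemma incidence_space_lagrangian n (M : cmap n) tail : (0 < n)%N ->
  is_orientation M tail -> lagrangian (incidence_space M tail).
Proof.
move=> n_gt0 tailP; have iso := incidence_space_isotropic tailP.
split=> //; apply/eqP; rewrite eqn_leq isotropic_dim //=.
rewrite -(leq_add2l n.+1) addSn addnn; apply: leq_trans (dim_cycles1 M n_gt0) _.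
rewrite -(limg_ker_dim (linfun (incidence_chain M tail))) -incidence_spaceE.
by rewrite leq_add2r dim_cycles1_ker_incidence.
Qed.

(** * Reflections and Lagrangian pairs *)

Section Reflection.
Variables (n : nat) (j : 'I_n) (e : rat).
Hypothesis e2 : e * e = 1.

(* The reflection in the vector [j - e j^*] (for [e = 1] or [e = -1]), and    *)
(* the pairing with this vector.                                              *)
Definition swap_edge (x : W n) : W n :=
  (\row_i (if i == j then e * x.2 0 i else x.1 0 i),
   \row_i (if i == j then e * x.1 0 i else x.2 0 i)).
Definition swap_defect (x : W n) : rat^o := x.2 0 j - e * x.1 0 j.

Fact swap_defect_is_linear : linear swap_defect.
Proof. by move=> a x y; rewrite /swap_defect /= !mxE /GRing.scale /=; ring. Qed.
HB.instance Definition _ :=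
  GRing.isLinear.Build rat (W n) rat^o *:%R swap_defect swap_defect_is_linear.

Definition scaled_graph (u : 'rV[rat]_n) : W n := (u, e *: u).

Fact scaled_graph_is_linear : linear scaled_graph.
Proof.
move=> a u v; congr (_, _); apply/rowP=> i; rewrite !mxE; ring.
Qed.
HB.instance Definition _ :=
  GRing.isLinear.Build rat 'rV[rat]_n (W n) *:%R scaled_graph
    scaled_graph_is_linear.

Lemma swap_edge_id x : swap_defect x = 0 -> swap_edge x = x.
Proof.
move=> /eqP; rewrite subr_eq0 => /eqP x2; case: x x2 => x1 x2 /= x2j.
congr (_, _); apply/rowP=> i; rewrite mxE; case: eqP => // ->; rewrite /= x2j //.
by rewrite mulrA e2 mul1r.
Qed.

Lemma hyp_form_swap_edge x y :
  hyp_form x (swap_edge y) = hyp_form x y + e * swap_defect x * swap_defect y.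
Proof.
rewrite /hyp_form (bigD1 j) //= [in RHS](bigD1 j) //= [RHS]addrAC; congr (_ + _).
  rewrite !mxE eqxx /swap_defect; apply/eqP; rewrite -subr_eq0; apply/eqP.
  transitivity ((e * e - 1) *
    (x.1 0 j * y.2 0 j + x.2 0 j * y.1 0 j - e * x.1 0 j * y.1 0 j)); first by ring.
  by rewrite e2 subrr mul0r.
by apply: eq_bigr => i /negPf ij; rewrite !mxE ij.
Qed.

(* The hyperplane of vanishing defect contains the definite subspace          *)
(* [{(u, e u)}] of dimension n, so its isotropic subspaces have dimension     *)
(* less than n.                                                               *)
Lemma lagrangian_swap_defect (L : {vspace W n}) :
  lagrangian L -> exists2 x, x \in L & swap_defect x != 0.
Proof.
move=> [isoL dimL]; set K := lker (linfun swap_defect).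
have [/subvP LK|/subvPn[x xL]] := boolP (L <= K)%VS; last first.
  by rewrite memv_ker lfunE; exists x.
have e_neq0 : e != 0 by apply: contraPneq e2 => ->; rewrite mul0r.
pose P := limg (linfun scaled_graph).
have dimP : \dim P = n.
  rewrite limg_dim_eq ?dimvf ?dim_row //.
  apply/eqP; rewrite -subv0; apply/subvP=> u; rewrite memv_cap memv_ker.
  by rewrite lfunE memv0 => /andP[_ /eqP[->]].
have LP0 : (L :&: P = 0)%VS.
  apply/eqP; rewrite -subv0; apply/subvP=> w; rewrite memv_cap => /andP[wL].
  case/memv_imgP=> u _; rewrite lfunE /= => wE; rewrite memv0.
  have formE : hyp_form w w = (e + e) * \sum_i u 0 i ^+ 2.
    by rewrite wE mulr_sumr; apply: eq_bigr => i _; rewrite !mxE; ring.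
  have /eqP := isoL _ _ wL wL; rewrite formE mulf_eq0 -mulr2n mulrn_eq0.
  rewrite (negPf e_neq0) /= => /eqP/psumr_eq0P u0.
  rewrite wE; suff -> : u = 0 by rewrite linear0.
  apply/rowP=> i; rewrite mxE; apply/eqP; rewrite -sqrf_eq0.
  by apply/eqP/u0 => // k _; apply: sqr_ge0.
have PK : (P <= K)%VS.
  apply/subvP=> _ /memv_imgP[u _ ->]; rewrite memv_ker !lfunE /=.
  by rewrite /swap_defect !mxE subrr.
have : (L + P <= K)%VS by rewrite subv_add PK andbT; apply/subvP.
move/dimvS; have := dimv_sum_cap L P; rewrite LP0 dimv0 addn0 dimP dimL => ->.
rewrite -dim_pair -dimvf => dimK.
have /eqP KT : K == fullv by rewrite eqEdim subvf.
have : (0, delta_mx 0 j) \in K by rewrite KT memvf.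
rewrite memv_ker lfunE /= /swap_defect !mxE !eqxx mulr0 subr0.
by rewrite oner_eq0.
Qed.

(** The reflection fixes the vectors of [L] with zero defect, so these lie in both spaces and form a
    subspace of dimension at least n-1. If [L] were equal to [L'], pairing x with its image would
    give [e * swap_defect x ^+ 2 = 0] on all of [L], against [lagrangian_swap_defect]. *)
Lemma lagrangian_pair_swap (L L' : {vspace W n}) :
  lagrangian L -> lagrangian L' -> (forall x, x \in L -> swap_edge x \in L') ->
  lagrangian_pair L L'.
Proof.
move=> lagL lagL' LL'; split=> //; have [isoL' _] := lagL'; have [_ dimL] := lagL.
have e_neq0 : e != 0 by apply: contraPneq e2 => ->; rewrite mul0r.
apply/eqP; rewrite eqn_leq; apply/andP; split.
  have n_gt0 : (0 < n)%N by apply: leq_ltn_trans (ltn_ord j).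
  rewrite leq_subRL // add1n -[ltnRHS]dimL ltn_neqAle dimvS ?capvSl // andbT.
  apply/negP=> /eqP dimI.
  have /eqP LE : (L :&: L' == L)%VS by rewrite eqEdim capvSl dimI /=.
  have [x xL] := lagrangian_swap_defect lagL.
  have xL' : x \in L' by move: xL; rewrite -{1}LE memv_cap => /andP[].
  have := isoL' _ _ xL' (LL' _ xL); rewrite hyp_form_swap_edge (isoL' _ _ xL' xL').
  by move/eqP; rewrite add0r !mulf_eq0 (negPf e_neq0) orbb /= => ->.
rewrite leq_subLR addnC -[leqLHS]dimL -(limg_ker_dim (linfun swap_defect) L).
apply: leq_add; last by rewrite -[leqRHS]/(dim rat^o) -dimvf dimvS ?subvf.
apply/dimvS/subvP=> x; rewrite !memv_cap memv_ker lfunE => /andP[xL /eqP x0].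
by rewrite xL -(swap_edge_id x0) LL'.
Qed.

End Reflection.

(** * Chains of the partial dual *)

Definition dual_chain n (M : cmap n) (j : 'I_n) (c : W n.*2) : W n.*2 :=
  (\row_x (if edge_of M x == j then - c.2 0 x else c.1 0 x),
   \row_x (if edge_of M x == j then - c.1 0 x else c.2 0 x)).

(** In the notation g, h above, [dual_chain] keeps g and composes h with the transposition c_j,
    which cancels the c_j in the new vertex permutation. *)
Lemma dual_chain_cycle n (M : cmap n) j c :
  c \in cycles1 M -> dual_chain M j c \in cycles1 (partial_dual M j).
Proof.
move=> /cycles1P cM; apply/cycles1P=> x /=; rewrite permM !mxE edge_cycleE.
transitivity (c.1 0 x - c.2 0 x); first by case: ifP => // _; ring.
rewrite cM; have [sj|sj] := boolP (edge_of M (sigma M x) == j).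
  by rewrite !edge_of_alpha sj alpha_invol; ring.
by rewrite edge_of_alpha (negPf sj).
Qed.

Theorem theorem4p4 (n : nat) (M : cmap n) (j : 'I_n)
    (tail0 tailj : 'I_n -> 'I_n.*2)
    (htail0 : is_orientation M tail0)
    (htailj : is_orientation (partial_dual M j) tailj)
    (hcompat : forall i : 'I_n, i != j -> tailj i = tail0 i) :
  lagrangian_pair (incidence_space M tail0)
                  (incidence_space (partial_dual M j) tailj).
Proof.
have n_gt0 : (0 < n)%N by apply: leq_ltn_trans (ltn_ord j).
have [e e2 dualE] : exists2 e : rat, e * e = 1 & forall c,
    incidence_chain (partial_dual M j) tailj (dual_chain M j c)
    = swap_edge j e (incidence_chain M tail0 c).
  have dualE i c : i != j ->
      intersection_edge (partial_dual M j) tailj (dual_chain M j c) i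
        = intersection_edge M tail0 c i /\
      intersection_coedge (partial_dual M j) tailj (dual_chain M j c) i
        = intersection_coedge M tail0 c i.
    move=> ij; rewrite /intersection_edge /intersection_coedge /= !mxE.
    by rewrite edge_of_alpha hcompat // htail0 (negPf ij).
  have : edge_of M (tailj j) == edge_of M (tail0 j).
    by rewrite htail0; apply/eqP/htailj.
  (* The sign is 1 if both orientations of the edge j start at the same label, and -1 if they start
     at opposite ones. *)
  rewrite edge_of_eq => /orP[]/eqP tE; [exists 1 | exists (-1)];
    rewrite ?mulrNN ?mulr1 // => c; congr (_, _); apply/rowP=> i;
    rewrite !mxE; case: eqVneq => [->|/dualE-/(_ c)[]] //;
    rewrite /intersection_edge /intersection_coedge /= !mxE tE ?alpha_invol;
    rewrite ?edge_of_alpha htail0 eqxx; ring.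
apply: (lagrangian_pair_swap (j := j) e2); try exact: incidence_space_lagrangian.
move=> x; rewrite !incidence_spaceE => /memv_imgP[c cM ->].
rewrite lfunE -dualE; apply/memv_imgP; exists (dual_chain M j c).
  exact: dual_chain_cycle.
by rewrite lfunE.
Qed.
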